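(* Let $E=(E_1,E_2,E_3):\mathbb{R}^3\to\mathbb{C}^3$ satisfy the quasi-periodic condition $E(\mathbf{x}+\mathbf{a}_\ell)=e^{\imath 2\pi \mathbf{k}\cdot\mathbf{a}_\ell}E(\mathbf{x})$ for all $\mathbf{x}\in\mathbb{R}^3$ and $\ell=1,2,3$. Then $$\mathrm{vec}\big(E_1(\hat{0}:\hat{n}_1-1,\,0:n_2-1,\,n_3)\big)=e^{\imath 2\pi\mathbf{k}\cdot\mathbf{a}_3}J_3\,\mathrm{vec}\big(E_1(\hat{0}:\hat{n}_1-1,\,0:n_2-1,\,0)\big)$$ and $$\mathrm{vec}\big(E_2(0:n_1-1,\,\hat{0}:\hat{n}_2-1,\,n_3)\big)=e^{\imath 2\pi\mathbf{k}\cdot\mathbf{a}_3}J_3\,\mathrm{vec}\big(E_2(0:n_1-1,\,\hat{0}:\hat{n}_2-1,\,0)\big),$$ where $J_3\in\mathbb{C}^{n_1n_2\times n_1n_2}$ is the matrix given by the four-case formula in the context.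
   Context: $\imath=\sqrt{-1}$; $\mathbf{k}\in\mathbb{R}^3$ is a fixed vector ($2\pi\mathbf{k}$ is the Bloch wave vector). The lattice translation vectors $\mathbf{a}_1,\mathbf{a}_2,\mathbf{a}_3\in\mathbb{R}^3$ are linearly independent and of the form $\mathbf{a}_1=(\|\mathbf{a}_1\|,0,0)^\top$, $\mathbf{a}_2=(\|\mathbf{a}_2\|\cos\theta_\gamma,\ \|\mathbf{a}_2\|\sin\theta_\gamma,\ 0)^\top$, $\mathbf{a}_3=(\|\mathbf{a}_3\|\cos\theta_\beta,\ \|\mathbf{a}_3\|\frac{\cos\theta_\alpha-\cos\theta_\gamma\cos\theta_\beta}{\sin\theta_\gamma},\ l_3)^\top$ with angles $\theta_\alpha,\theta_\beta,\theta_\gamma\in(0,\pi)$, $l_3=\|\mathbf{a}_3\|\frac{\sqrt{1-\cos^2\theta_\gamma-\cos^2\theta_\beta-\cos^2\theta_\alpha+2\cos\theta_\gamma\cos\theta_\beta\cos\theta_\alpha}}{\sin\theta_\gamma}>0$, and $\|\mathbf{a}_1\|\ge\|\mathbf{a}_2\|,\|\mathbf{a}_3\|$. Put $l_1=\|\mathbf{a}_1\|$, $l_2=\|\mathbf{a}_2\|\sin\theta_\gamma$; $n_1,n_2,n_3$ are positive integers and $\delta_x=l_1/n_1$, $\delta_y=l_2/n_2$, $\delta_z=l_3/n_3$. The lattice is adapted to the grid: there are integers $0\le m_1,m_2\le n_1$ and $0\le m_3\le n_2$ with - $m_1=\frac{\|\mathbf{a}_2\|\cos\theta_\gamma}{\delta_x}$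 if $\cos\theta_\gamma\ge0$, and $m_1=\frac{\|\mathbf{a}_1\|+\|\mathbf{a}_2\|\cos\theta_\gamma}{\delta_x}$ if $\cos\theta_\gamma<0$; - $m_2=\frac{\|\mathbf{a}_3\|\cos\theta_\beta}{\delta_x}$ if $\cos\theta_\beta\ge0$, and $m_2=\frac{\|\mathbf{a}_1\|+\|\mathbf{a}_3\|\cos\theta_\beta}{\delta_x}$ if $\cos\theta_\beta<0$; - $m_3=\frac{\|\mathbf{a}_3\|}{\delta_y}\frac{\cos\theta_\alpha-\cos\theta_\gamma\cos\theta_\beta}{\sin\theta_\gamma}$ if $\cos\theta_\alpha-\cos\theta_\gamma\cos\theta_\beta\ge0$, and $m_3=\frac{\|\mathbf{a}_2\|\sin^2\theta_\gamma+\|\mathbf{a}_3\|(\cos\theta_\alpha-\cos\theta_\gamma\cos\theta_\beta)}{\delta_y\sin\theta_\gamma}$ otherwise. Constants: $\rho_1=\lceil\frac{2\theta_\gamma}{\pi}-1\rceil$, $\rho_2=\lceil\frac{2\theta_\beta}{\pi}-1\rceil$, $\rho_3=\lceil\cos\theta_\gamma\cos\theta_\beta-\cos\theta_\alpha\rceil$ (so $\rho_3=0$ if $\cos\theta_\alpha-\cos\theta_\gamma\cos\theta_\beta\ge0$ and $\rho_3=1$ otherwise), $\rho_4=\lceil\cos\theta_\gamma\cos\theta_\beta(\cos\theta_\gamma\cos\theta_\beta-\cos\theta_\alpha)\rceil$, $\rho_5=\lceil\cos\theta_\beta\rceil$. When $\rho_3=0$: $\psi_1=1$ if $(\rho_2n_1-m_2)-(\rho_1n_1-m_1)>0$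 and $\psi_1=0$ if $(\rho_2n_1-m_2)-(\rho_1n_1-m_1)\le0$. When $\rho_3=1$: $\psi_2=1$ if $(\rho_1n_1-m_1)+(\rho_2n_1-m_2)>0$ and $\psi_2=0$ if $(\rho_1n_1-m_1)+(\rho_2n_1-m_2)\le0$. Let $J_1=e^{\imath2\pi\rho_2\mathbf{k}\cdot\mathbf{a}_1}\begin{bmatrix}0&e^{-\imath2\pi\mathbf{k}\cdot\mathbf{a}_1}I_{m_2}\\ I_{n_1-m_2}&0\end{bmatrix}$, and for an integer $0\le m\le n_1$ let $S_m=\begin{bmatrix}0&e^{-\imath2\pi\mathbf{k}\cdot\mathbf{a}_1}I_{m}\\ I_{n_1-m}&0\end{bmatrix}\in\mathbb{C}^{n_1\times n_1}$. Then $J_3$ is: (1) if $\cos\theta_\alpha-\cos\theta_\gamma\cos\theta_\beta\ge0$ and $m_1\le m_2$: $J_3=e^{\imath2\pi\rho_3\mathbf{k}\cdot\mathbf{a}_2}\begin{bmatrix}0&e^{-\imath2\pi\mathbf{k}\cdot(\mathbf{a}_2+\rho_1\rho_4\mathbf{a}_1-\psi_1\mathbf{a}_1)}I_{m_3}\otimes S_{m_2-m_1}\\ I_{n_2-m_3}\otimes J_1&0\end{bmatrix}$; (2) if $\cos\theta_\alpha-\cos\theta_\gamma\cos\theta_\beta\ge0$ and $m_1>m_2$: $J_3=e^{\imath2\pi\rho_3\mathbf{k}\cdot\mathbf{a}_2}\begin{bmatrix}0&e^{-\imath2\pi\mathbf{k}\cdot(\mathbf{a}_2-\rho_2\rho_4\mathbf{a}_1-\psi_1\mathbf{a}_1)}I_{m_3}\otimes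 S_{n_1-m_1+m_2}\\ I_{n_2-m_3}\otimes J_1&0\end{bmatrix}$; (3) if $\cos\theta_\alpha-\cos\theta_\gamma\cos\theta_\beta<0$ and $m_1+m_2\le n_1$: $J_3=e^{\imath2\pi\rho_3\mathbf{k}\cdot\mathbf{a}_2}\begin{bmatrix}0&e^{-\imath2\pi\mathbf{k}\cdot\mathbf{a}_2}I_{m_3}\otimes J_1\\ e^{\imath2\pi(\rho_1\rho_4+\psi_2)\mathbf{k}\cdot\mathbf{a}_1}I_{n_2-m_3}\otimes S_{m_1+m_2}&0\end{bmatrix}$; (4) if $\cos\theta_\alpha-\cos\theta_\gamma\cos\theta_\beta<0$ and $m_1+m_2>n_1$: $J_3=e^{\imath2\pi\rho_3\mathbf{k}\cdot\mathbf{a}_2}\begin{bmatrix}0&e^{-\imath2\pi\mathbf{k}\cdot\mathbf{a}_2}I_{m_3}\otimes J_1\\ e^{-\imath2\pi(\rho_5\rho_4-\psi_2)\mathbf{k}\cdot\mathbf{a}_1}I_{n_2-m_3}\otimes S_{m_1+m_2-n_1}&0\end{bmatrix}$. For real $r,s,t$ put $\mathbf{x}(r,s,t)=(r\delta_x,s\delta_y,t\delta_z)^\top$ and $E_\ell(r,s,t)=E_\ell(\mathbf{x}(r,s,t))$. A hat on an index means a shift by one half ($\hat{i}=i+\tfrac12$). $E_1(\hat{0}:\hat{n}_1-1,0:n_2-1,t)$ is the $n_1\times n_2$ matrix with entries $E_1(\hat{i},j,t)$, and $E_2(0:n_1-1,\hat{0}:\hat{n}_2-1,t)$ the $n_1\times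 n_2$ matrix with entries $E_2(i,\hat{j},t)$, $0\le i\le n_1-1$, $0\le j\le n_2-1$. $\mathrm{vec}$ stacks the columns of a matrix; $\otimes$ is the Kronecker product; $I_m$ is the identity of order $m$.
   Formalization: In case (3) with m_1+m_2=n_1, the formal theorem additionally assumes ρ_1=ρ_2 or e^{i2πk·a_1}=1; otherwise the lower-left block of J_3 is off by the factor e^{i2πk·a_1} and the claim is false. *)

(* Defs.v *)
From HB Require Import structures.
From mathcomp Require Import all_boot all_order all_algebra.
From mathcomp Require Import reals trigo.
From mathcomp Require Import complex mxtens.

Set Implicit Arguments.
Unset Strict Implicit.
Unset Printing Implicit Defensive.

Import Order.TTheory GRing.Theory Num.Theory.
Local Open Scope ring_scope.
Local Open Scope complex_scope.

Definition vec3 (R : realType) (x y z : R) : 'cV[R]_3 :=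
  \col_(i < 3) [:: x; y; z]`_i.

Definition dotv (R : realType) (u v : 'cV[R]_3) : R :=
  \sum_(i < 3) u i 0 * v i 0.

(* MathComp-Analysis puts the sup norm on matrices, hence a separate Euclidean
   norm. *)
Definition enorm (R : realType) (u : 'cV[R]_3) : R := Num.sqrt (dotv u u).

(* [bloch k v] is exp (2 i pi (k . v)), so exp (- 2 i pi (k . v)) is
   [bloch k (- v)]. *)
Definition bloch (R : realType) (k v : 'cV[R]_3) : R[i] :=
  cos (2 * pi * dotv k v) +i* sin (2 * pi * dotv k v).

Section Constants.
Variable R : realType.
Implicit Types ta tb tg : R.

Definition rho1 tg : int := Num.ceil (2 * tg / pi - 1).
Definition rho2 tb : int := Num.ceil (2 * tb / pi - 1).
Definition rho3 ta tb tg : int := Num.ceil (cos tg * cos tb - cos ta).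
Definition rho4 ta tb tg : int :=
  Num.ceil (cos tg * cos tb * (cos tg * cos tb - cos ta)).
Definition rho5 tb : int := Num.ceil (cos tb).

(* Only meaningful (and only used) when [rho3 ta tb tg = 0]. *)
Definition psi1 tb tg (n1 m1 m2 : nat) : int :=
  if 0 < (rho2 tb * n1%:Z - m2%:Z) - (rho1 tg * n1%:Z - m1%:Z) then 1 else 0.

(* Only meaningful (and only used) when [rho3 ta tb tg = 1]. *)
Definition psi2 tb tg (n1 m1 m2 : nat) : int :=
  if 0 < (rho1 tg * n1%:Z - m1%:Z) + (rho2 tb * n1%:Z - m2%:Z) then 1 else 0.

End Constants.

(* The matrix [ 0 B ; C 0 ], whose order p + q is only propositionally equal to
   N where it is used. [conform_mx] transports it to order N; the default value
   0 is returned only if p + q <> N, which the bounds on m1, m2, m3 exclude. *)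
Definition antiblock (K : pzRingType) (N p q : nat) (B : 'M[K]_p) (C : 'M[K]_q) :
  'M[K]_N := conform_mx (0 : 'M[K]_N) (block_mx 0 B C 0).
Arguments antiblock {K} N {p q} B C.

Definition Smx (R : realType) (k a1 : 'cV[R]_3) (n1 m : nat) : 'M[R[i]]_n1 :=
  antiblock n1 (bloch k (- a1) *: (1%:M : 'M_m)) (1%:M : 'M_(n1 - m)).

Definition J1 (R : realType) (k a1 : 'cV[R]_3) (tb : R) (n1 m2 : nat) :
  'M[R[i]]_n1 := bloch k (a1 *~ rho2 tb) *: Smx k a1 n1 m2.

(* In the third branch, on the boundary m1 + m2 = n1 with exactly one of tg, tb
   obtuse (rho1 tg <> rho2 tb), psi2 is 0 and the lower-left phase is off by the
   factor bloch k a1; the fourth branch would give the right value there. This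
   is the only case in which J3 is not the translation matrix along a3. *)
Definition J3 (R : realType) (k a1 a2 : 'cV[R]_3) (ta tb tg : R)
    (n1 n2 m1 m2 m3 : nat) : 'M[R[i]]_(n2 * n1) :=
  let r1 := rho1 tg in let r2 := rho2 tb in
  let r4 := rho4 ta tb tg in let r5 := rho5 tb in
  let p1 := psi1 tb tg n1 m1 m2 in let p2 := psi2 tb tg n1 m1 m2 in
  let I_top : 'M[R[i]]_m3 := 1%:M in
  let I_bot : 'M[R[i]]_(n2 - m3) := 1%:M in
  let J := J1 k a1 tb n1 m2 in
  let S := Smx k a1 n1 in
  bloch k (a2 *~ rho3 ta tb tg) *:
  (if 0 <= cos ta - cos tg * cos tb then
     if (m1 <= m2)%N then
       antiblock (n2 * n1)
         (bloch k (- (a2 + a1 *~ (r1 * r4) - a1 *~ p1))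
            *: (I_top *t S (m2 - m1)%N))
         (I_bot *t J)
     else
       antiblock (n2 * n1)
         (bloch k (- (a2 - a1 *~ (r2 * r4) - a1 *~ p1))
            *: (I_top *t S (n1 - m1 + m2)%N))
         (I_bot *t J)
   else
     if (m1 + m2 <= n1)%N then
       antiblock (n2 * n1)
         (bloch k (- a2) *: (I_top *t J))
         (bloch k (a1 *~ (r1 * r4 + p2)) *: (I_bot *t S (m1 + m2)%N))
     else
       antiblock (n2 * n1)
         (bloch k (- a2) *: (I_top *t J))
         (bloch k (- (a1 *~ (r5 * r4 - p2)))
            *: (I_bot *t S (m1 + m2 - n1)%N))).

(* Column stacking: entry (i, j) of A is put at position j * p + i, the value
   of [mxtens_index (j, i)]. ([mxvec] stacks rows.) *)
Definition vec (K : Type) (p q : nat) (A : 'M[K]_(p, q)) : 'cV[K]_(q * p) :=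
  \col_l A (mxtens_unindex l).2 (mxtens_unindex l).1.

Section Grid.
Variable R : realType.
Implicit Type E : 'cV[R]_3 -> 'cV[R[i]]_3.

Definition quasi_periodic (k a : 'cV[R]_3) E : Prop :=
  forall x : 'cV[R]_3, E (x + a) = bloch k a *: E x.

(* Components are numbered from 0: [E x 0 0] is E_1 (x), [E x 1 0] is E_2 (x). *)
Definition E1_slice E (dx dy dz : R) (n1 n2 : nat) (t : R) : 'M[R[i]]_(n1, n2) :=
  \matrix_(i < n1, j < n2)
    E (vec3 ((i%:R + 2^-1) * dx) (j%:R * dy) (t * dz)) 0 0.

Definition E2_slice E (dx dy dz : R) (n1 n2 : nat) (t : R) : 'M[R[i]]_(n1, n2) :=
  \matrix_(i < n1, j < n2)
    E (vec3 (i%:R * dx) ((j%:R + 2^-1) * dy) (t * dz)) 1 0.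

End Grid.

(* Main.v *)
Require Import Defs.
From HB Require Import structures.
From mathcomp Require Import all_boot all_order all_algebra.
From mathcomp Require Import reals trigo.
From mathcomp Require Import complex mxtens.
From mathcomp Require Import zify ring lra.

Set Implicit Arguments.
Unset Strict Implicit.
Unset Printing Implicit Defensive.

Import Order.TTheory GRing.Theory Num.Theory.
Local Open Scope ring_scope.
Local Open Scope complex_scope.

(** The statement is a computation with translations. Fix a component of [E] and
    an offset (half a step in one coordinate), and let [F i j] be the value of
    that component at the grid point [(i, j)] of the plane [t = 0], for all
    integers [i] and [j]. In grid steps, the adaptedness conditions say that
    - [a1] is [(n1, 0, 0)],
    - [a2] is [(m1 - rho1 n1, n2, 0)],
    - [a3] is [(m2 - rho2 n1, m3 - rho3 n2, n3)].

    The condition along [a3] therefore turns the slice at [t = n3] into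
    [bloch k a3] times the values of [F] at points shifted by
    [(m2 - rho2 n1, m3 - rho3 n2)], and it remains to see that [J3] performs
    this shift on the slice at [t = 0] ([mul_J3]). A shifted index which leaves
    the range [0 <= i < n1], [0 <= j < n2] is brought back by the conditions
    along [a1] and [a2], and this is what the block matrices do:
    - [Smx m] shifts by [m] any sequence that picks up the phase [bloch k a1]
      over a period [n1] ([mul_Smx]), and [J1] does so by [m2 - rho2 n1];
    - an outer block matrix [[0, I ** P; I ** Q, 0]] shifts the columns
      cyclically by [m3], applying [P] to those that wrap around and [Q] to the
      others ([mul_antiblock_tens]).

    For one of the two groups of columns, coming back to the range costs a
    translation by [a2], which also moves [i] by [m1 - rho1 n1]. The resulting
    row shift is [m2 - m1] or [m1 + m2] up to a multiple of [n1]; reducing it to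
    the interval [[0, n1]] produces a power of [bloch k a1]. The constants
    [rho4], [rho5], [psi1], [psi2] encode the exponent of this power: that is
    the content of [psi1_le], [psi1_gt], [psi2_le] and [psi2_gt]. They follow
    from the signs of the cosines, because [|a2|, |a3| <= |a1|] forces
    [m1, m2 < n1], with [m1 = 0] or [m2 = 0] only for a right angle. *)

(** * Block matrices acting on stacked vectors *)

Lemma mul_antiblock (K : pzRingType) (N p q : nat) (B : 'M[K]_p)
    (C : 'M[K]_q) (f : nat -> K) (e : (p + q)%N = N) :
  antiblock N B C *m (\col_(h < N) f h)
    = castmx (e, erefl 1%N)
        (col_mx (B *m \col_(h < p) f (q + h)%N) (C *m \col_(h < q) f h)).
Proof.
case: N / e; rewrite castmx_id /antiblock.
rewrite -(conform_castmx (erefl _, addnC q p)) conform_mx_id.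
have -> : \col_(h < p + q) f h = castmx (addnC q p, erefl 1%N)
    (col_mx (\col_(h < q) f h) (\col_(h < p) f (q + h)%N)).
  apply/matrixP => h z; rewrite castmxE !mxE /= -[h in LHS](cast_ordKV (addnC q p)).
  by case: (split_ordP (cast_ord _ h)) => h' ->; rewrite mxE.
rewrite mulmx_cast castmx_comp !castmx_id mul_block_col.
by rewrite !mul0mx add0r addr0.
Qed.

Lemma mul_tens1mx (K : comPzRingType) (p n : nat) (S : 'M[K]_n) (f : nat -> K)
    (j : 'I_p) (i : 'I_n) :
  (((1%:M : 'M_p) *t S) *m \col_(l < p * n) f l) (mxtens_index (j, i)) 0
    = (S *m \col_(h < n) f (j * n + h)%N) i 0.
Proof.
rewrite [LHS]mxE [RHS]mxE (reindex (@mxtens_index p n)) /=; last first.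
  by exists (@mxtens_unindex p n) => x _; rewrite (mxtens_indexK, mxtens_unindexK).
rewrite (eq_bigr (fun l => (1%:M j l.1 * S i l.2) * f (l.1 * n + l.2)%N)); last first.
  by move=> [j' i'] _; rewrite tensmxE [X in _ * X]mxE.
rewrite -(pair_bigA _ (fun j' i' => (1%:M j j' * S i i') * f (j' * n + i')%N)) /=.
rewrite (bigD1 j) //= [X in _ + X]big1 ?addr0 => [|j' nej]; last first.
  apply: big1 => i' _.
  by rewrite mxE eq_sym (negbTE nej) !mul0r.
apply: eq_bigr => h _.
by rewrite !mxE eqxx mul1r.
Qed.

(** Stacked columns are consecutive segments of length [n1]. The antidiagonal
    blocks send the last [m] of them to the front and the others to the back:
    a cyclic shift, in which only the columns that wrap around meet [P]. *)
Lemma mul_antiblock_tens (K : comPzRingType) (n1 n2 m : nat) (P Q : 'M[K]_n1)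
    (G : nat -> nat -> K) :
  (m <= n2)%N ->
  antiblock (n2 * n1) ((1%:M : 'M_m) *t P) ((1%:M : 'M_(n2 - m)) *t Q)
      *m vec (\matrix_(i < n1, j < n2) G i j)
    = vec (\matrix_(i < n1, j < n2)
             if (j < m)%N then (P *m \col_(h < n1) G h (n2 - m + j)%N) i 0
             else (Q *m \col_(h < n1) G h (j - m)%N) i 0).
Proof.
move=> lemn.
have -> : vec (\matrix_(i < n1, j < n2) G i j)
    = \col_(l < n2 * n1) G (l %% n1)%N (l %/ n1)%N.
  by apply/matrixP => l z; rewrite !mxE.
have e : (m * n1 + (n2 - m) * n1 = n2 * n1)%N by rewrite -mulnDl subnKC.
rewrite (mul_antiblock _ _ (fun l => G (l %% n1)%N (l %/ n1)%N) e).
apply/matrixP => l z; rewrite castmxE ord1 [z]ord1.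
case: (mxtens_indexP l) => j i {l}.
rewrite [RHS]mxE mxtens_indexK [RHS]mxE /=.
have n1_gt0 : (0 < n1)%N by apply: leq_ltn_trans (ltn_ord i).
rewrite mxE; case: splitP => l /=; case: (mxtens_indexP l) => j' i' {l} /= el.
- have ej : j = j' :> nat.
    by move/(congr1 (divn^~ n1)): el; rewrite !divnMDl // !divn_small ?addn0.
  have -> : i = i' by apply: ord_inj; move: el; rewrite ej => /addnI.
  rewrite ej ltn_ord.
  rewrite (mul_tens1mx _ (fun l => G (((n2 - m) * n1 + l) %% n1)%N
                                     (((n2 - m) * n1 + l) %/ n1)%N)).
  congr ((_ *m _) _ _).
  apply/matrixP => h ?; rewrite !mxE addnA -mulnDl.
  by rewrite modnMDl modn_small // divnMDl // divn_small ?addn0.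
have ej : j = (m + j')%N :> nat.
  move/(congr1 (divn^~ n1)): el.
  by rewrite addnA -mulnDl !divnMDl // !divn_small ?addn0.
have -> : i = i' by apply: ord_inj; move: el; rewrite ej mulnDl -addnA => /addnI/addnI.
rewrite ej ltnNge leq_addr addKn.
rewrite (mul_tens1mx _ (fun l => G (l %% n1)%N (l %/ n1)%N)).
congr ((_ *m _) _ _).
apply/matrixP => h ?; rewrite !mxE.
by rewrite modnMDl modn_small // divnMDl // divn_small ?addn0.
Qed.

(** * Quasi-periodic sequences and their shifts *)

Section Shift.
Variables (R : realType) (k : 'cV[R]_3).

Lemma blochD u v : bloch k (u + v) = bloch k u * bloch k v.
Proof.
rewrite /bloch; have -> : dotv k (u + v) = dotv k u + dotv k v.
  by rewrite /dotv -big_split; apply: eq_bigr => i _; rewrite !mxE mulrDr.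
by rewrite mulrDr cosD sinD; apply/eqP; rewrite eq_complex /= eqxx /= addrC.
Qed.

Lemma bloch0 : bloch k 0 = 1.
Proof.
have -> : bloch k 0 = cos 0 +i* sin 0.
  by rewrite /bloch /dotv big1 ?mulr0 // => i _; rewrite mxE mulr0.
by rewrite cos0 sin0.
Qed.

Lemma blochNK v x : bloch k (- v) * (bloch k v * x) = x.
Proof. by rewrite mulrA -blochD addNr bloch0 mul1r. Qed.

Lemma bloch_iter (a : 'cV[R]_3) (d : int) (g : int -> R[i]) (s z : int) :
  (forall z, g (z + d) = bloch k a * g z) ->
  g (z + s * d) = bloch k (a *~ s) * g z.
Proof.
move=> hg.
have pos (n : nat) y : g (y + n%:Z * d) = bloch k (a *+ n) * g y.
  elim: n => [|n IH] in y *; first by rewrite mul0r addr0 mulr0n bloch0 mul1r.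
  by rewrite -addn1 PoszD mulrDl mul1r addrA hg IH mulrnDr mulr1n blochD mulrCA mulrA.
case: s => n; first exact: pos.
rewrite NegzE mulrNz -[LHS](blochNK (a *+ n.+1)) -pos.
by congr (_ * g _); ring.
Qed.

(** For [i < m] the index [i - m] is negative; the upper right block reads
    [g (i - m + n1)] instead, and its phase undoes the added period. *)
Lemma mul_Smx (a1 : 'cV[R]_3) (n1 m : nat) (g : int -> R[i]) :
  (m <= n1)%N -> (forall z, g (z + n1%:Z) = bloch k a1 * g z) ->
  Smx k a1 n1 m *m (\col_(i < n1) g i) = \col_(i < n1) g (i%:Z - m%:Z).
Proof.
move=> lemn hg; rewrite (mul_antiblock _ _ (fun h => g h) (subnKC lemn)).
apply/matrixP => i z; rewrite castmxE [RHS]mxE ord1 mxE.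
case: splitP => h /= ->.
  rewrite -scalemxAl mul1mx !mxE -[RHS](blochNK a1) -hg.
  by congr (_ * g _); lia.
by rewrite mul1mx mxE; congr g; lia.
Qed.

(** The prefactor [bloch k (a1 *~ rho2 tb)] of [J1] adds [rho2 tb] periods to
    the shift by [m]. *)
Lemma mul_J1 (a1 : 'cV[R]_3) (tb : R) (n1 m : nat) (g : int -> R[i]) :
  (m <= n1)%N -> (forall z, g (z + n1%:Z) = bloch k a1 * g z) ->
  J1 k a1 tb n1 m *m (\col_(i < n1) g i)
    = \col_(i < n1) g (i%:Z - (m%:Z - rho2 tb * n1%:Z)).
Proof.
move=> lemn hg; rewrite -scalemxAl mul_Smx //; apply/matrixP => i z.
by rewrite !mxE -(bloch_iter _ _ hg); congr g; ring.
Qed.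

End Shift.

(** * The phase exponents *)

Lemma ceil_unit (R : realType) (x : R) : -1 < x -> x < 1 ->
  Num.ceil x = if x <= 0 then 0 else 1.
Proof.
move=> x_gtN1 x_lt1; apply: ceil_def; case: ifP => x_le0.
  by rewrite sub0r x_le0 mulrN1z x_gtN1.
by rewrite subrr ltNge x_le0 ltW.
Qed.

Lemma cos_itv (R : realType) (t : R) : 0 < t < pi -> -1 < cos t < 1.
Proof.
move=> /sin_gt0_pi; have := sin2cos2 t; nra.
Qed.

Lemma rho1E (R : realType) (t : R) : 0 < t < pi ->
  rho1 t = if 0 <= cos t then 0 else 1.
Proof.
move=> /andP[t_gt0 t_ltpi]; have pi0 : 0 < pi :> R by apply: pi_gt0.
have ub : 2 * t / pi < 2 by rewrite ltr_pdivrMr //; lra.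
have lb : 0 < 2 * t / pi by rewrite divr_gt0 //; lra.
rewrite /rho1 ceil_unit; [|lra|lra].
rewrite lerBlDr add0r ler_pdivrMr // mul1r.
case: (leP (2 * t) pi) => ht; first by rewrite cos_ge0_pihalf //; apply/andP; split; lra.
rewrite leNgt; suff -> : cos t < 0 by [].
rewrite -[cos t]opprK -sinBpihalf oppr_lt0 sin_gt0_pi //; lra.
Qed.

Lemma rho2E (R : realType) (t : R) : 0 < t < pi ->
  rho2 t = if 0 <= cos t then 0 else 1.
Proof. exact: rho1E. Qed.

(** What the exponents need to know of a grid coordinate [m] attached to an
    angle of cosine [c]: it is already reduced modulo [n], and its vanishing detects
    the right angle, on which the ceilings in [rho4] and [rho5] depend. *)
Definition adapted (R : realType) (c : R) (n m : nat) :=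
  (m < n)%N /\ ((m == 0)%N = (c == 0)).

Lemma adapted_sign (R : realType) (c : R) (n m : nat) : adapted c n m ->
  [/\ (m < n)%N, (c == 0) = (m == 0)%N & (m == 0)%N ==> (0 <= c)].
Proof. by move=> [ltmn ->]; split=> //; apply/implyP => /eqP ->. Qed.

Lemma mulr_ge0_sign (R : realDomainType) (x y : R) :
  (0 <= x * y) = [|| x == 0, y == 0 | (0 <= x) == (0 <= y)].
Proof.
case: (ltrgt0P x) => [x0|x0|->]; last by rewrite mul0r lexx.
  by rewrite pmulr_rge0 //; case: (ltrgt0P y).
by rewrite nmulr_rge0 //; case: (ltrgt0P y).
Qed.

Lemma mulr_le0_sign (R : realDomainType) (x y : R) :
  (x * y <= 0) = [|| x == 0, y == 0 | (0 <= x) != (0 <= y)].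
Proof.
case: (ltrgt0P x) => [x0|x0|->]; last by rewrite mul0r lexx.
  by rewrite pmulr_rle0 //; case: (ltrgt0P y).
by rewrite nmulr_rle0 //; case: (ltrgt0P y).
Qed.

Section Exponents.
Variables (R : realType) (ta tb tg : R) (n1 m1 m2 : nat).
Hypotheses (htb : 0 < tb < pi) (htg : 0 < tg < pi).
Hypothesis hA : `|cos ta - cos tg * cos tb| < 1.
Hypotheses (hm1 : adapted (cos tg) n1 m1) (hm2 : adapted (cos tb) n1 m2).

Lemma rho3E : rho3 ta tb tg = if 0 <= cos ta - cos tg * cos tb then 0 else 1.
Proof.
move: hA; rewrite ltr_norml => /andP[lb ub].
by rewrite /rho3 -opprB ceil_unit ?oppr_le0 //; lra.
Qed.

Lemma rho4E : rho4 ta tb tg =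
  if 0 <= cos tg * cos tb * (cos ta - cos tg * cos tb) then 0 else 1.
Proof.
have /andP[cg1 cg2] := cos_itv htg; have /andP[cb1 cb2] := cos_itv htb.
have : `|cos tg * cos tb * (cos ta - cos tg * cos tb)| < 1.
  rewrite !normrM !mulr_ilt1 ?mulr_ge0 ?normr_ge0 // ltr_norml; lra.
rewrite ltr_norml => /andP[lb ub].
rewrite /rho4 -[cos tg * cos tb - cos ta]opprB mulrN ceil_unit ?oppr_le0 //; lra.
Qed.

Lemma rho5E : rho5 tb = if cos tb <= 0 then 0 else 1.
Proof. by have /andP[? ?] := cos_itv htb; rewrite /rho5 ceil_unit. Qed.

(** In the next four lemmas the left-hand side is the number of periods by which
    the true row shift differs from the one made by the block [Smx] of [J3], and
    the right-hand side is the exponent found in [J3]. Once the cosines are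
    replaced by their signs, only linear integer arithmetic is left. *)
Lemma psi1_le : 0 < cos ta - cos tg * cos tb -> (m1 <= m2)%N ->
  rho2 tb - rho1 tg = psi1 tb tg n1 m1 m2 - rho1 tg * rho4 ta tb tg.
Proof.
move=> A0; have [lt1 eq1 ge1] := adapted_sign hm1.
have [lt2 eq2 ge2] := adapted_sign hm2.
rewrite /psi1 rho1E // rho2E // rho4E pmulr_lge0 // mulr_ge0_sign eq1 eq2.
move: ge1 ge2; clear -lt1 lt2.
by case: (0 <= cos tg); case: (0 <= cos tb) => /=;
  do 2?case: ifP; lia.
Qed.

Lemma psi1_gt : 0 < cos ta - cos tg * cos tb -> (m2 < m1)%N ->
  rho2 tb - rho1 tg + 1 = psi1 tb tg n1 m1 m2 + rho2 tb * rho4 ta tb tg.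
Proof.
move=> A0; have [lt1 eq1 ge1] := adapted_sign hm1.
have [lt2 eq2 ge2] := adapted_sign hm2.
rewrite /psi1 rho1E // rho2E // rho4E pmulr_lge0 // mulr_ge0_sign eq1 eq2.
move: ge1 ge2; clear -lt1 lt2.
by case: (0 <= cos tg); case: (0 <= cos tb) => /=;
  do 2?case: ifP; lia.
Qed.

(** If [m1 + m2 = n1] then [psi2] vanishes whenever [rho1 tg + rho2 tb = 1], and
    the two sides differ by one; hence the last hypothesis. *)
Lemma psi2_le : cos ta - cos tg * cos tb < 0 -> (m1 + m2 <= n1)%N ->
  ((m1 + m2 = n1)%N -> rho1 tg = rho2 tb) ->
  rho1 tg + rho2 tb = rho1 tg * rho4 ta tb tg + psi2 tb tg n1 m1 m2.
Proof.
move=> A0; have [lt1 eq1 ge1] := adapted_sign hm1.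
have [lt2 eq2 ge2] := adapted_sign hm2.
rewrite /psi2 rho1E // rho2E // rho4E nmulr_lge0 // mulr_le0_sign eq1 eq2.
move: ge1 ge2; clear -lt1 lt2.
by case: (0 <= cos tg); case: (0 <= cos tb) => /=;
  do 2?case: ifP; lia.
Qed.

Lemma psi2_gt : cos ta - cos tg * cos tb < 0 -> (n1 < m1 + m2)%N ->
  rho1 tg + rho2 tb - 1
    = - (rho5 tb * rho4 ta tb tg - psi2 tb tg n1 m1 m2).
Proof.
move=> A0; have [lt1 eq1 ge1] := adapted_sign hm1.
have [lt2 eq2 ge2] := adapted_sign hm2.
rewrite /psi2 rho1E // rho2E // rho4E rho5E nmulr_lge0 // mulr_le0_sign.
rewrite [cos tb <= 0]le_eqVlt ltNge eq1 eq2.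
move: ge1 ge2; clear -lt1 lt2.
by case: (0 <= cos tg); case: (0 <= cos tb) => /=;
  do 3?case: ifP; lia.
Qed.

End Exponents.

(** * J3 as a translation *)

Lemma tensmxZr (K : comPzRingType) (m n p q : nat) (c : K) (A : 'M[K]_(m, n))
    (B : 'M[K]_(p, q)) : c *: (A *t B) = A *t (c *: B).
Proof. by apply/matrixP => i j; rewrite !mxE mulrCA. Qed.

(** The block [J1] already makes the required shift, so the work is in the block
    [Smx]: there the index [j] is off by [n2], and [lattice] compares [F] at
    the two points, which differ by [a2] and a multiple of [a1]. *)
Lemma mul_J3 (R : realType) (k a1 a2 : 'cV[R]_3) (ta tb tg : R)
    (n1 n2 m1 m2 m3 : nat) (F : int -> int -> R[i]) :
    0 < tb < pi -> 0 < tg < pi -> `|cos ta - cos tg * cos tb| < 1 ->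
    adapted (cos tg) n1 m1 -> adapted (cos tb) n1 m2 -> (m3 <= n2)%N ->
    ((0 < m3)%N -> cos ta - cos tg * cos tb != 0) ->
    (cos ta - cos tg * cos tb < 0 -> (m1 + m2 = n1)%N ->
       rho1 tg = rho2 tb \/ bloch k a1 = 1) ->
    (forall i j : int, F (i + n1%:Z) j = bloch k a1 * F i j) ->
    (forall i j : int, F (i + (m1%:Z - rho1 tg * n1%:Z)) (j + n2%:Z)
                         = bloch k a2 * F i j) ->
  J3 k a1 a2 ta tb tg n1 n2 m1 m2 m3 *m vec (\matrix_(i < n1, j < n2) F i j)
    = vec (\matrix_(i < n1, j < n2)
             F (i%:Z - (m2%:Z - rho2 tb * n1%:Z))
               (j%:Z - (m3%:Z - rho3 ta tb tg * n2%:Z))).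
Proof.
move=> htb htg hA hm1 hm2 lem3 hA0 hb hF1 hF2.
have lem1 : (m1 <= n1)%N by case: hm1 => /ltnW.
have lem2 : (m2 <= n1)%N by case: hm2 => /ltnW.
have hF s i j : F (i + s * n1%:Z) j = bloch k (a1 *~ s) * F i j.
  exact: (bloch_iter (g := F^~ j)).
have lattice s i j i' j' :
    i' = i + (m1%:Z - rho1 tg * n1%:Z) + s * n1%:Z -> j' = j + n2%:Z ->
  F i' j' = bloch k (a2 + a1 *~ s) * F i j.
  by move=> -> ->; rewrite hF hF2 addrC blochD mulrA.
have mulS m (j : nat) (i : 'I_n1) : (m <= n1)%N ->
    (Smx k a1 n1 m *m (\col_(h < n1) F h j)) i 0 = F (i%:Z - m%:Z) j.
  by move=> lemn; rewrite (mul_Smx (g := F^~ j)) // mxE.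
have mulJ (j : nat) (i : 'I_n1) :
    (J1 k a1 tb n1 m2 *m (\col_(h < n1) F h j)) i 0
      = F (i%:Z - (m2%:Z - rho2 tb * n1%:Z)) j.
  by rewrite (mul_J1 _ (g := F^~ j)) // mxE.
rewrite /J3 (rho3E hA); case: (leP 0 (cos ta - cos tg * cos tb)) => A_sign.
- rewrite mulr0z bloch0 scale1r.
  (* The exponents agree for a nonzero defect only; when it is zero, so is m3,
     and the block that carries the exponent is empty. *)
  have A_gt0 (j : 'I_n2) : (j < m3)%N -> 0 < cos ta - cos tg * cos tb.
    by move=> ltj; rewrite lt_def A_sign hA0 // (leq_ltn_trans _ ltj).
  case: leqP => lem12; rewrite tensmxZr
    (mul_antiblock_tens _ _ (fun i j : nat => F i j)) //.
  + congr vec; apply/matrixP => i j; rewrite [LHS]mxE [RHS]mxE /=.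
    case: ltnP => ltj; last first.
      by rewrite mulJ; congr F; lia.
    have := psi1_le htb htg hA hm1 hm2 (A_gt0 _ ltj) lem12.
    set r4 := rho4 _ _ _; set p1 := psi1 _ _ _ _ _ => e.
    rewrite -scalemxAl [LHS]mxE mulS; last by lia.
    rewrite -addrA -mulrNz -mulrzDr.
    rewrite (lattice (rho1 tg * r4 - p1) (i%:Z - (m2%:Z - rho2 tb * n1%:Z))
                     (j%:Z - m3%:Z)); first by rewrite blochNK mul0r subr0.
    * have -> : p1 = rho2 tb - rho1 tg + rho1 tg * r4 by rewrite e; ring.
      by rewrite -subzn //; ring.
    * by lia.
  + congr vec; apply/matrixP => i j; rewrite [LHS]mxE [RHS]mxE /=.
    case: ltnP => ltj; last first.
      by rewrite mulJ; congr F; lia.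
    have := psi1_gt htb htg hA hm1 hm2 (A_gt0 _ ltj) lem12.
    set r4 := rho4 _ _ _; set p1 := psi1 _ _ _ _ _ => e.
    rewrite -scalemxAl [LHS]mxE mulS; last by lia.
    rewrite -addrA -!mulrNz -mulrzDr.
    rewrite (lattice (- (rho2 tb * r4) - p1) (i%:Z - (m2%:Z - rho2 tb * n1%:Z))
                     (j%:Z - m3%:Z)); first by rewrite blochNK mul0r subr0.
    * have -> : p1 = rho2 tb - rho1 tg + 1 - rho2 tb * r4 by rewrite e; ring.
      by rewrite PoszD -subzn //; ring.
    * by lia.
- rewrite mulr1z -scalemxAl.
  case: leqP => lem12; rewrite !tensmxZr
    (mul_antiblock_tens _ _ (fun i j : nat => F i j)) //.
  + apply/matrixP => l z; rewrite [LHS]mxE 2![X in _ * X]mxE 2![RHS]mxE /=.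
    case: ltnP => ltj.
      rewrite -scalemxAl [X in _ * X]mxE mulJ mulrA -blochD subrr bloch0 mul1r.
      by congr F; lia.
    rewrite -scalemxAl [X in _ * X]mxE mulS // mulrA -blochD.
    have -> : bloch k (a2 + a1 *~ (rho1 tg * rho4 ta tb tg + psi2 tb tg n1 m1 m2))
            = bloch k (a2 + a1 *~ (rho1 tg + rho2 tb)).
      (* If a1 carries no phase, then any multiple of it can be used. *)
      have [a1_1|a1_n1] := eqVneq (bloch k a1) 1.
        have triv s : bloch k (a1 *~ s) = 1.
          have := @bloch_iter _ k a1 0 (fun=> 1) s 0.
          by rewrite a1_1 mul1r mulr1 => <-.
        by rewrite !blochD !triv.
      rewrite -(psi2_le htb htg hA hm1 hm2) // => e.
      by case: (hb A_sign e) => // a1_1; rewrite a1_1 eqxx in a1_n1.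
    apply/esym/lattice; last by lia.
    by rewrite PoszD; ring.
  + apply/matrixP => l z; rewrite [LHS]mxE 2![X in _ * X]mxE 2![RHS]mxE /=.
    case: ltnP => ltj.
      rewrite -scalemxAl [X in _ * X]mxE mulJ mulrA -blochD subrr bloch0 mul1r.
      by congr F; lia.
    rewrite -scalemxAl [X in _ * X]mxE mulS; last by lia.
    rewrite mulrA -mulrNz -(psi2_gt htb htg hA hm1 hm2) // -blochD.
    apply/esym/lattice; last by lia.
    by rewrite -subzn ?PoszD ?(ltnW lem12) //; ring.
Qed.

(** * Lattice vectors in grid units *)

Lemma vec3D (R : realType) (x y z x' y' z' : R) :
  vec3 x y z + vec3 x' y' z' = vec3 (x + x') (y + y') (z + z').
Proof. by apply/matrixP => [[[|[|[|//]]] ?] j]; rewrite !mxE. Qed.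

Lemma enorm_ge0 (R : realType) (u : 'cV[R]_3) : 0 <= enorm u.
Proof. exact: sqrtr_ge0. Qed.

(** Since [e <= l] and [|c| < 1], the abscissa [e * c] lies strictly between
    [- l] and [l]; the coordinate [m] is its representative modulo the [n] grid
    steps of [l]. *)
Lemma adapted_offset (R : realType) (c e l dx : R) (n m : nat) :
    (0 < n)%N -> 0 < e <= l -> -1 < c < 1 -> dx = l / n%:R ->
    m%:R = (if 0 <= c then e * c / dx else (l + e * c) / dx) ->
  adapted c n m /\
  e * c = (m%:Z - (if 0 <= c then 0 else 1) * n%:Z)%:~R * dx.
Proof.
move=> n_gt0 /andP[e_gt0 lel] /andP[c_gtN1 c_lt1] dxE.
have nR_gt0 : 0 < n%:R :> R by rewrite ltr0n.
have dx_gt0 : 0 < dx by rewrite dxE divr_gt0 //; lra.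
have lE : l = n%:R * dx by rewrite dxE; field; lra.
have ltmn (x : R) : m%:R = x / dx -> x < l -> (m < n)%N.
  by move=> mE xl; rewrite -(ltr_nat R) mE ltr_pdivrMr // -lE.
case: leP => c_sign mE.
- split; [split|].
  + by apply: ltmn mE _; nra.
  + rewrite -(pnatr_eq0 R) mE !mulf_eq0 invr_eq0.
    by rewrite (gt_eqF e_gt0) (gt_eqF dx_gt0) orbF.
  + by rewrite mul0r subr0 -[_%:~R]/(m%:R) mE divfK // gt_eqF.
- split; [split|].
  + by apply: ltmn mE _; nra.
  + rewrite (lt_eqF c_sign) -(pnatr_eq0 R) mE gt_eqF // divr_gt0 //; nra.
  + rewrite mul1r rmorphB /= -[m%:~R]/(m%:R) -[n%:~R]/(n%:R) mE mulrBl -lE.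
    by rewrite divfK ?gt_eqF //; ring.
Qed.

Section Grid.
Variables (R : realType) (k : 'cV[R]_3).
Variables (E : 'cV[R]_3 -> 'cV[R[i]]_3) (dx dy dz al be : R) (c : 'I_3).

(** The sample of the component [c] at an integer point, with the half-step
    offsets in [al] and [be], so that one argument serves both slices. *)
Definition grid (i j : int) (t : R) : R[i] :=
  E (vec3 ((i%:~R + al) * dx) ((j%:~R + be) * dy) (t * dz)) c 0.

Lemma grid_shift (a : 'cV[R]_3) (p q : int) (r : R) :
  quasi_periodic k a E -> a = vec3 (p%:~R * dx) (q%:~R * dy) (r * dz) ->
  forall (i j : int) (t : R),
  grid (i + p) (j + q) (t + r) = bloch k a * grid i j t.
Proof.
move=> hE aE i j t; have := hE (vec3 ((i%:~R + al) * dx) ((j%:~R + be) * dy) (t * dz)).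
rewrite {1}aE vec3D => /(congr1 (fun u : 'cV[R[i]]_3 => u c 0)).
rewrite [RHS]mxE => <-; congr (E (vec3 _ _ _) c 0); rewrite ?rmorphD /=; ring.
Qed.
End Grid.

(** The hypothesis says that the Gram determinant of three unit vectors with
    these mutual angles is positive. It equals
    [sin tg ^+ 2 * sin tb ^+ 2 - (cos ta - cos tg * cos tb) ^+ 2]. *)
Lemma triple_cos_lt (R : realType) (ta tb tg : R) :
    0 < 1 - cos tg ^+ 2 - cos tb ^+ 2 - cos ta ^+ 2
        + 2 * cos tg * cos tb * cos ta ->
  `|cos ta - cos tg * cos tb| < 1.
Proof.
move=> gram_gt0; rewrite -(ltr_pXn2r (n := 2)) ?nnegrE ?normr_ge0 // expr1n.
rewrite real_normK ?num_real //.
have : 0 <= (1 - cos tg ^+ 2) * (1 - cos tb ^+ 2).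
  by rewrite -!sin2cos2 mulr_ge0 ?sqr_ge0.
move: (sqr_ge0 (cos tg)) (sqr_ge0 (cos tb)) (cos2Dsin2 tg) (cos2Dsin2 tb).
move: (sqr_ge0 (sin tg)) (sqr_ge0 (sin tb)).
nra.
Qed.

(** * The translation along a3 *)

Theorem theorem3p3 (R : realType) (k a1 a2 a3 : 'cV[R]_3)
    (ta tb tg : R) (l1 l2 l3 dx dy dz : R) (n1 n2 n3 m1 m2 m3 : nat)
    (E : 'cV[R]_3 -> 'cV[R[i]]_3)
    (hfree : free [:: a1; a2; a3])
    (hta : 0 < ta < pi) (htb : 0 < tb < pi) (htg : 0 < tg < pi)
    (hl1 : l1 = enorm a1)
    (hl2 : l2 = enorm a2 * sin tg)
    (hl3 : l3 = enorm a3 *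
       (Num.sqrt (1 - cos tg ^+ 2 - cos tb ^+ 2 - cos ta ^+ 2
                  + 2 * cos tg * cos tb * cos ta) / sin tg))
    (hl3_gt0 : 0 < l3)
    (ha1 : a1 = vec3 (enorm a1) 0 0)
    (ha2 : a2 = vec3 (enorm a2 * cos tg) (enorm a2 * sin tg) 0)
    (ha3 : a3 = vec3 (enorm a3 * cos tb)
                     (enorm a3 * ((cos ta - cos tg * cos tb) / sin tg)) l3)
    (ha21 : enorm a2 <= enorm a1) (ha31 : enorm a3 <= enorm a1)
    (hn1 : (0 < n1)%N) (hn2 : (0 < n2)%N) (hn3 : (0 < n3)%N)
    (hdx : dx = l1 / n1%:R) (hdy : dy = l2 / n2%:R) (hdz : dz = l3 / n3%:R)
    (hm1n : (m1 <= n1)%N) (hm2n : (m2 <= n1)%N) (hm3n : (m3 <= n2)%N)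
    (hm1 : m1%:R = (if 0 <= cos tg then enorm a2 * cos tg / dx
                    else (enorm a1 + enorm a2 * cos tg) / dx))
    (hm2 : m2%:R = (if 0 <= cos tb then enorm a3 * cos tb / dx
                    else (enorm a1 + enorm a3 * cos tb) / dx))
    (hm3 : m3%:R = (if 0 <= cos ta - cos tg * cos tb
                    then enorm a3 / dy * ((cos ta - cos tg * cos tb) / sin tg)
                    else (enorm a2 * sin tg ^+ 2
                          + enorm a3 * (cos ta - cos tg * cos tb))
                         / (dy * sin tg)))
    (hboundary : cos ta - cos tg * cos tb < 0 -> (m1 + m2 = n1)%N ->
       rho1 tg = rho2 tb \/ bloch k a1 = 1)
    (hE1 : quasi_periodic k a1 E)
    (hE2 : quasi_periodic k a2 E)
    (hE3 : quasi_periodic k a3 E) :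
  vec (E1_slice E dx dy dz n1 n2 n3%:R)
    = bloch k a3 *: (J3 k a1 a2 ta tb tg n1 n2 m1 m2 m3
                     *m vec (E1_slice E dx dy dz n1 n2 0))
  /\
  vec (E2_slice E dx dy dz n1 n2 n3%:R)
    = bloch k a3 *: (J3 k a1 a2 ta tb tg n1 n2 m1 m2 m3
                     *m vec (E2_slice E dx dy dz n1 n2 0)).
Proof.
have sg_gt0 := sin_gt0_pi htg.
have l3_gt0 : 0 < enorm a3 * (Num.sqrt (1 - cos tg ^+ 2 - cos tb ^+ 2
    - cos ta ^+ 2 + 2 * cos tg * cos tb * cos ta) / sin tg) by rewrite -hl3.
have e3_gt0 : 0 < enorm a3.
  rewrite lt_def enorm_ge0 andbT; apply: contraTneq l3_gt0 => ->.
  by rewrite mul0r ltxx.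
have A_lt1 : `|cos ta - cos tg * cos tb| < 1.
  apply: triple_cos_lt; move: l3_gt0.
  by rewrite pmulr_rgt0 // pmulr_lgt0 ?invr_gt0 // sqrtr_gt0.
have e2_gt0 : 0 < enorm a2.
  rewrite lt_def enorm_ge0 andbT; apply/eqP => e2_0.
  have /(free_not0 hfree) : a2 \in [:: a1; a2; a3] by rewrite !inE eqxx orbT.
  case/eqP; rewrite ha2 e2_0 !mul0r.
  by apply/matrixP => [[[|[|[|//]]] ?] j]; rewrite !mxE.
have [adapt1 off1] : adapted (cos tg) n1 m1 /\
    enorm a2 * cos tg = (m1%:Z - rho1 tg * n1%:Z)%:~R * dx.
  rewrite rho1E //; apply: (adapted_offset (l := l1)); rewrite ?hl1 ?e2_gt0 ?cos_itv //.
  by rewrite hdx hl1.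
have [adapt2 off2] : adapted (cos tb) n1 m2 /\
    enorm a3 * cos tb = (m2%:Z - rho2 tb * n1%:Z)%:~R * dx.
  rewrite rho2E //; apply: (adapted_offset (l := l1)); rewrite ?hl1 ?e3_gt0 ?cos_itv //.
  by rewrite hdx hl1.
have n1R : n1%:R != 0 :> R by rewrite pnatr_eq0 -lt0n.
have n2R : n2%:R != 0 :> R by rewrite pnatr_eq0 -lt0n.
have n3R : n3%:R != 0 :> R by rewrite pnatr_eq0 -lt0n.
have sgR : sin tg != 0 by rewrite gt_eqF.
have l2E : n2%:R * dy = enorm a2 * sin tg by rewrite hdy hl2 mulrC divfK.
have dy_neq0 : dy != 0.
  by apply: contraTneq (mulr_gt0 e2_gt0 sg_gt0) => dy0; rewrite -l2E dy0 mulr0 ltxx.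
have off3 : enorm a3 * ((cos ta - cos tg * cos tb) / sin tg)
    = (m3%:Z - rho3 ta tb tg * n2%:Z)%:~R * dy.
  rewrite (rho3E A_lt1) rmorphB rmorphM /= -[m3%:~R]/(m3%:R) -[n2%:~R]/(n2%:R).
  move: hm3; case: ifP => _ ->; first by rewrite mul0r subr0; field; apply/andP.
  by rewrite mul1r [RHS]mulrBl l2E; field; apply/andP.
have nz3 : (0 < m3)%N -> cos ta - cos tg * cos tb != 0.
  rewrite -(ltr0n R) hm3 => + ; apply: contraTneq => ->.
  by rewrite lexx mul0r mulr0 ltxx.
have a1E : a1 = vec3 (n1%:Z%:~R * dx) (0%:~R * dy) (0 * dz).
  by rewrite {1}ha1 -[n1%:~R]/(n1%:R) hdx hl1 !mul0r mulrC divfK.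
have a2E : a2 = vec3 ((m1%:Z - rho1 tg * n1%:Z)%:~R * dx) (n2%:Z%:~R * dy) (0 * dz).
  by rewrite {1}ha2 off1 -l2E mul0r.
have a3E : a3 = vec3 ((m2%:Z - rho2 tb * n1%:Z)%:~R * dx)
    ((m3%:Z - rho3 ta tb tg * n2%:Z)%:~R * dy) (n3%:R * dz).
  by rewrite {1}ha3 off2 off3 hdz [n3%:R * _]mulrC divfK.
have layer al be c : let F := grid E dx dy dz al be c in
    vec (\matrix_(i < n1, j < n2) F i j n3%:R)
      = bloch k a3 *: (J3 k a1 a2 ta tb tg n1 n2 m1 m2 m3
                        *m vec (\matrix_(i < n1, j < n2) F i j 0)).
  move=> F; have [hF1 hF2 hF3] := And3 (grid_shift al be c hE1 a1E)
    (grid_shift al be c hE2 a2E) (grid_shift al be c hE3 a3E).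
  rewrite (mul_J3 (F := fun i j => F i j 0)) //.
  - apply/matrixP => l z; rewrite 2!mxE [RHS]mxE [X in _ * X]mxE mxE.
    by rewrite -hF3 add0r !subrK.
  - by move=> i j; rewrite -hF1 !addr0.
  - by move=> i j; rewrite -hF2 addr0.
have sliceE1 t : E1_slice E dx dy dz n1 n2 t
    = \matrix_(i < n1, j < n2) grid E dx dy dz 2^-1 0 0 i j t.
  by apply/matrixP => i j; rewrite !mxE /grid addr0.
have sliceE2 t : E2_slice E dx dy dz n1 n2 t
    = \matrix_(i < n1, j < n2) grid E dx dy dz 0 2^-1 1 i j t.
  by apply/matrixP => i j; rewrite !mxE /grid addr0.
by rewrite !sliceE1 !sliceE2; split; apply: layer.
Qed.
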